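(* Let $\{A_t\}_{t\in[0,1]}$ be an admissible deformation of stratified $P$-algebras, $F:\mathcal M\to\mathcal N$ a strong monoidal base-change functor, and $$G_t:=\operatorname{supp}\bigl(\sigma(F_*(A_t))\bigr),\quad L_t:=\bigcup_{S\in\mathrm{Str}(P)}\operatorname{supp}\bigl(\sigma(F_S(A_{S,t}))\bigr),\quad R_t:=G_t\setminus L_t=\Sigma^{\mathrm{res}}(F,A_t,P),$$ satisfying the standing deformation assumptions (continuity of $G_t,L_t$; local separation and tracking of $R_t$; interface localization for all $t$). Assume in addition that the residual trace $$\mathfrak R:=\bigcup_{t\in[0,1]}\{t\}\times R_t\subset[0,1]\times\mathbb C$$ is locally trivial over $[0,1]$, i.e. the projection $\pi:\mathfrak R\to[0,1]$, $\pi(t,z)=t$, is a locally trivial bundle with fiber $R_t$. Then for all $s,t\in[0,1]$ the residual supports $R_s$ and $R_t$ are homeomorphic (and therefore homotopy equivalent). Consequently $$H_k(R_s;\mathbb K)\cong H_k(R_t;\mathbb K)\quad\text{and}\quad H^k(R_s;\mathbb K)\cong H^k(R_t;\mathbb K)$$ for every $k\ge0$ and every coefficient field $\mathbb K$. Moreover, if the interface localization decomposition $R_t=\bigsqcup_{I\in\mathcal I(P)}\mathcal L_I(F,A_t,P)$ is itself preserved as a locally trivial decomposition (for each $I$, the projection $\bigcup_t\{t\}\times\mathcal L_I(F,A_t,P)\to[0,1]$ is a locally trivial bundle), then each localized defect family $\mathcal L_I(F,A_t,P)$ has locally constant homology and cohomology; hence the Betti numbers $$\beta_k\bigl(\mathcal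 L_I(F,A_t,P)\bigr)=\dim_{\mathbb K}H_k\bigl(\mathcal L_I(F,A_t,P);\mathbb K\bigr)$$ do not depend on $t$.
   Context: $\mathcal M,\mathcal N$ are cocomplete symmetric monoidal categories. A stratified operad is a $C$-colored operad $P$ in $\mathcal M$ together with a partition $C=\bigsqcup_{\alpha}S_\alpha$ of its colors into finitely or countably many nonempty sets (strata; $\mathrm{Str}(P)$ is the set of strata) such that, for each stratum $S$, the operations all of whose input and output colors lie in $S$ form a suboperad $P_S$, and compositions involving at least one operation with colors in more than one stratum are again such mixed operations or operations supported in a single stratum. $\{A_t\}_{t\in[0,1]}$ is a family of $P$-algebras; $A_{S,t}$ is the restriction of $A_t$ to the colors in $S$. A strong monoidal functor $F$ induces operads $F_*P$, $F_*P_S$ in $\mathcal N$ and algebras $F_*(A_t)$ and $F_S(A_{S,t}):=F_*(A_{S,t})$ over them. Spectra: for an algebra $B$ over a colored operad $Q$, the operadic spectrum $\sigma(B)=\sigma_Q(B)$ is an object of the base category, namely the relative tensor product over $Q$ of a Hochschild-type object of $B$ with a residual spectral object of $Q$. A spectral realization with values in subsets of $\mathbb C$ is fixed, and $\operatorname{supp}(\sigma(B))\subseteq\mathbb C$ is the realization of $\sigma_Q(B)$. Local supports are regarded as subsets of the global support. Subsets of $\mathbb C$ carry the subspace topology. Interfaces: the admissible interface set $\mathcal I(P)$ is the smallest set of operations of $P$ containing all mixed-color operations (those whose input and output colors are not all in a single stratum) and such that any defined composition of two admissible interfaces, or of an admissible interface with an operation inside a single stratum, is either in $\mathcal I(P)$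 or is an operation inside a single stratum. The coupling tensor $\tau_I(t)$ is the structure morphism of $A_t$ induced by $I$, $\operatorname{Supp}_I(\tau_I(t))\subseteq\mathbb C$ its assigned spectral support, and $\mathcal L_I(F,A_t,P):=\Sigma^{\mathrm{res}}(F,A_t,P)\cap\operatorname{Supp}_I(\tau_I(t))$. Standing deformation assumptions: (1) $G_t$ and $L_t$ vary continuously in the Hausdorff metric on compact subsets of $\mathbb C$; (2) there is $\delta>0$, locally uniform in $t$, with $\operatorname{dist}(R_t,L_t)\ge\delta$, and $R_t$ is tracked by a continuous selection (for every $t_0$, $\lambda\in R_{t_0}$ there is a continuous $\lambda(\cdot)$ near $t_0$ with $\lambda(t_0)=\lambda$, $\lambda(t)\in R_t$) or by norm-continuous Riesz projections onto the part $R_t$ of the spectrum $G_t$ of bounded operators $T_t$; (3) $R_t=\bigcup_{I\in\mathcal I(P)}\mathcal L_I(F,A_t,P)$ for all $t$. Locally trivial bundle: every $t_0\in[0,1]$ has an open neighborhood $U$ (in $[0,1]$) and a homeomorphism $\pi^{-1}(U)\cong U\times R_{t_0}$ (resp. $U\times\mathcal L_I(F,A_{t_0},P)$) commuting with the projections to $U$. *)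

(* Defs.v *)
From HB Require Import structures.
From Stdlib Require List.
From mathcomp Require Import all_boot all_order all_algebra.
From mathcomp Require Import all_classical all_reals all_analysis.
From mathcomp.multinomials Require Import freeg.
From mathcomp.real_closed Require Import complex.

Set Implicit Arguments.
Unset Strict Implicit.
Unset Printing Implicit Defensive.

Import Order.TTheory GRing.Theory Num.Theory numFieldNormedType.Exports.

Declare Scope cat_scope.
Delimit Scope cat_scope with cat.
Local Open Scope cat_scope.

Record category := Category {
  obj :> Type;
  mor : obj -> obj -> Type;
  idm : forall x, mor x x;
  compm : forall x y z, mor y z -> mor x y -> mor x z;
  compmA : forall x y z t (h : mor z t) (g : mor y z) (f : mor x y),
    compm h (compm g f) = compm (compm h g) f;
  comp1m : forall x y (f : mor x y), compm (idm y) f = f;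
  compm1 : forall x y (f : mor x y), compm f (idm x) = f }.

Arguments idm {c x}.
Notation "g ∘ f" := (compm g f) (at level 40, left associativity) : cat_scope.

Reserved Notation "x ⊗ y" (at level 38, right associativity).
Reserved Notation "f ⊠ g" (at level 38, right associativity).

Record smcat := SMCat {
  smcat_cat :> category;
  munit : smcat_cat;
  tenso : smcat_cat -> smcat_cat -> smcat_cat
    where "x ⊗ y" := (tenso x y);
  tensm : forall x x' y y' : smcat_cat,
    mor x x' -> mor y y' -> mor (x ⊗ y) (x' ⊗ y')
    where "f ⊠ g" := (tensm f g);
  assoc : forall x y z : smcat_cat, mor ((x ⊗ y) ⊗ z) (x ⊗ (y ⊗ z));
  associ : forall x y z : smcat_cat, mor (x ⊗ (y ⊗ z)) ((x ⊗ y) ⊗ z);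
  lunit : forall x : smcat_cat, mor (munit ⊗ x) x;
  luniti : forall x : smcat_cat, mor x (munit ⊗ x);
  runit : forall x : smcat_cat, mor (x ⊗ munit) x;
  runiti : forall x : smcat_cat, mor x (x ⊗ munit);
  braid : forall x y : smcat_cat, mor (x ⊗ y) (y ⊗ x);
  tensm1 : forall x y : smcat_cat, idm ⊠ idm = idm :> mor (x ⊗ y) (x ⊗ y);
  tensmD : forall (x y z x' y' z' : smcat_cat)
      (g : mor y z) (f : mor x y) (g' : mor y' z') (f' : mor x' y'),
    (g ∘ f) ⊠ (g' ∘ f') = (g ⊠ g') ∘ (f ⊠ f');
  assocK : forall x y z, associ x y z ∘ assoc x y z = idm;
  associK : forall x y z, assoc x y z ∘ associ x y z = idm;
  assoc_nat : forall (x x' y y' z z' : smcat_cat)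
      (f : mor x x') (g : mor y y') (h : mor z z'),
    assoc x' y' z' ∘ ((f ⊠ g) ⊠ h) = (f ⊠ (g ⊠ h)) ∘ assoc x y z;
  lunitK : forall x, luniti x ∘ lunit x = idm;
  lunitiK : forall x, lunit x ∘ luniti x = idm;
  lunit_nat : forall (x y : smcat_cat) (f : mor x y),
    lunit y ∘ (idm ⊠ f) = f ∘ lunit x;
  runitK : forall x, runiti x ∘ runit x = idm;
  runitiK : forall x, runit x ∘ runiti x = idm;
  runit_nat : forall (x y : smcat_cat) (f : mor x y),
    runit y ∘ (f ⊠ idm) = f ∘ runit x;
  braidK : forall x y, braid y x ∘ braid x y = idm;
  braid_nat : forall (x x' y y' : smcat_cat) (f : mor x x') (g : mor y y'),
    braid x' y' ∘ (f ⊠ g) = (g ⊠ f) ∘ braid x y;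
  triangle : forall x y,
    (idm ⊠ lunit y) ∘ assoc x munit y = runit x ⊠ idm;
  pentagon : forall x y z t,
    (idm ⊠ assoc y z t) ∘ assoc x (y ⊗ z) t ∘ (assoc x y z ⊠ idm) =
    assoc x y (z ⊗ t) ∘ assoc (x ⊗ y) z t;
  hexagon : forall x y z,
    assoc y z x ∘ braid x (y ⊗ z) ∘ assoc x y z =
    (idm ⊠ braid x z) ∘ assoc y x z ∘ (braid x y ⊠ idm) }.

Arguments munit {s}.
Notation "x ⊗ y" := (tenso x y) : cat_scope.
Notation "f ⊠ g" := (tensm f g) : cat_scope.

Definition swapl (M : smcat) (x y z : M) : mor (x ⊗ (y ⊗ z)) (y ⊗ (x ⊗ z)) :=
  assoc y x z ∘ (braid x y ⊠ idm) ∘ associ x y z.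

Definition swapr (M : smcat) (x y z : M) : mor ((x ⊗ y) ⊗ z) ((x ⊗ z) ⊗ y) :=
  associ x z y ∘ (idm ⊠ braid y z) ∘ assoc x y z.

(* Colimits of graph-shaped diagrams (no composition in the shape): these are
   the colimits over the free categories on the graphs, and they give all small
   colimits. *)
Record graph := Graph { vertex : Type; edge : vertex -> vertex -> Type }.

Record diagram (J : graph) (C : category) := Diagram {
  dobj : vertex J -> C;
  dmap : forall u v, edge u v -> mor (dobj u) (dobj v) }.

Record cocone (J : graph) (C : category) (D : diagram J C) := Cocone {
  apex : C;
  leg : forall u, mor (dobj D u) apex;
  leg_comm : forall u v (e : edge u v), leg v ∘ dmap D e = leg u }.

Definition is_colimit (J : graph) (C : category) (D : diagram J C)
    (c : cocone D) : Prop :=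
  forall c' : cocone D, exists! f : mor (apex c) (apex c'),
    forall u, f ∘ leg c u = leg c' u.

(* The universe of [graph] is a priori smaller than that of [category], so
   this does not force [C] to be a preorder. *)
Definition cocomplete (C : category) : Type :=
  forall (J : graph) (D : diagram J C), {c : cocone D | is_colimit c}.

Record cosmcat := CoSMCat {
  cosmcat_smcat :> smcat;
  colim : cocomplete cosmcat_smcat }.

Record smfunctor (M N : smcat) := SMFunctor {
  fobj :> M -> N;
  fmap : forall x y, mor x y -> mor (fobj x) (fobj y);
  fmu : forall x y, mor (fobj x ⊗ fobj y) (fobj (x ⊗ y));
  fmui : forall x y, mor (fobj (x ⊗ y)) (fobj x ⊗ fobj y);
  feps : mor munit (fobj munit);
  fepsi : mor (fobj munit) munit;
  fmap1 : forall x, fmap (@idm _ x) = idm;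
  fmapD : forall x y z (g : mor y z) (f : mor x y),
    fmap (g ∘ f) = fmap g ∘ fmap f;
  fmuK : forall x y, fmui x y ∘ fmu x y = idm;
  fmuiK : forall x y, fmu x y ∘ fmui x y = idm;
  fepsK : fepsi ∘ feps = idm;
  fepsiK : feps ∘ fepsi = idm;
  fmu_nat : forall x x' y y' (f : mor x x') (g : mor y y'),
    fmu x' y' ∘ (fmap f ⊠ fmap g) = fmap (f ⊠ g) ∘ fmu x y;
  fmu_assoc : forall x y z,
    fmap (assoc x y z) ∘ fmu (x ⊗ y) z ∘ (fmu x y ⊠ idm) =
    fmu x (y ⊗ z) ∘ (idm ⊠ fmu y z) ∘ assoc (fobj x) (fobj y) (fobj z);
  fmu_lunit : forall x,
    fmap (lunit x) ∘ fmu munit x ∘ (feps ⊠ idm) = lunit (fobj x);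
  fmu_runit : forall x,
    fmap (runit x) ∘ fmu x munit ∘ (idm ⊠ feps) = runit (fobj x);
  fmu_braid : forall x y,
    fmap (braid x y) ∘ fmu x y = fmu y x ∘ braid (fobj x) (fobj y) }.

(* Symmetric-group actions are indexed by words in adjacent transpositions;
   [reorder_pos p i] is the place in the target list of the entry at place [i]. *)
Inductive reorder (C : Type) : seq C -> seq C -> Type :=
| reorder_id l : reorder l l
| reorder_cons x l l' : reorder l l' -> reorder (x :: l) (x :: l')
| reorder_swap x y l : reorder [:: x, y & l] [:: y, x & l]
| reorder_trans l l' l'' : reorder l l' -> reorder l' l'' -> reorder l l''.

Fixpoint reorder_pos (C : Type) (l l' : seq C) (p : reorder l l') : nat -> nat :=
  match p with
  | reorder_id _ => id
  | reorder_cons _ _ _ p => fun i => if i is j.+1 then (reorder_pos p j).+1 else 0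
  | reorder_swap _ _ _ => fun i => if i is _.+2 then i else 1 - i
  | reorder_trans _ _ _ p q => fun i => reorder_pos q (reorder_pos p i)
  end.

(* [block_reorder]: [r] permutes [l1 ++ m ++ l2] as [p] permutes the list
   [l1 ++ c :: l2] with its entry [c] replaced by the block [m], itself
   permuted by [q]. *)
Definition skip_block (a k i : nat) : nat := if i < a then i else (i + k).-1.

Definition block_reorder (C : Type) (l1 l1' m m' l l' s s' : seq C)
    (p : reorder l l') (q : reorder m m') (r : reorder s s') : Prop :=
  [/\ reorder_pos p (size l1) = size l1',
      forall j, j < size m -> reorder_pos r (size l1 + j) = size l1' + reorder_pos q j
    & forall i, i < size l -> i != size l1 ->
      reorder_pos r (skip_block (size l1) (size m) i) =
      skip_block (size l1') (size m') (reorder_pos p i)].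

(* Partial compositions [op_comp : x, y |-> x o_c y].  The lists of colours are
   given up to equations, so that no transport occurs in the axioms. *)
Record operad (M : smcat) (C : Type) := Operad {
  op : seq C -> C -> M;
  op_perm : forall l l' d, reorder l l' -> mor (op l d) (op l' d);
  op_unit : forall c, mor munit (op [:: c] c);
  op_comp : forall l1 l2 m l r c d, l = l1 ++ c :: l2 -> r = l1 ++ m ++ l2 ->
    mor (op l d ⊗ op m c) (op r d);
  op_perm_ext : forall l l' d (p q : reorder l l'),
    reorder_pos p =1 reorder_pos q -> op_perm d p = op_perm d q;
  op_perm1 : forall l d, op_perm d (reorder_id l) = idm;
  op_permD : forall l l' l'' d (p : reorder l l') (q : reorder l' l''),
    op_perm d (reorder_trans p q) = op_perm d q ∘ op_perm d p;
  op_comp_unitr : forall l1 l2 l c d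
      (e : l = l1 ++ c :: l2) (e' : l = l1 ++ [:: c] ++ l2),
    op_comp d e e' ∘ (idm ⊠ op_unit c) ∘ runiti (op l d) = idm;
  op_comp_unitl : forall l d
      (e : [:: d] = [::] ++ d :: [::]) (e' : l = [::] ++ l ++ [::]),
    op_comp d e e' ∘ (op_unit d ⊠ idm) ∘ luniti (op l d) = idm;
  op_comp_seq : forall l1 l2 m1 m2 n l m s u r b c d
      (e1 : l = l1 ++ c :: l2) (e2 : s = l1 ++ m ++ l2)
      (e3 : s = (l1 ++ m1) ++ b :: (m2 ++ l2))
      (e4 : r = (l1 ++ m1) ++ n ++ (m2 ++ l2))
      (e5 : m = m1 ++ b :: m2) (e6 : u = m1 ++ n ++ m2)
      (e7 : r = l1 ++ u ++ l2),
    op_comp d e3 e4 ∘ (op_comp d e1 e2 ⊠ idm) =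
    op_comp d e1 e7 ∘ (idm ⊠ op_comp c e5 e6) ∘
      assoc (op l d) (op m c) (op n b);
  op_comp_par : forall l1 l2 l3 m n l s s' r b c d
      (e1 : l = l1 ++ b :: (l2 ++ c :: l3))
      (e2 : s = l1 ++ m ++ (l2 ++ c :: l3))
      (e3 : s = (l1 ++ m ++ l2) ++ c :: l3)
      (e4 : r = (l1 ++ m ++ l2) ++ n ++ l3)
      (e5 : l = (l1 ++ b :: l2) ++ c :: l3)
      (e6 : s' = (l1 ++ b :: l2) ++ n ++ l3)
      (e7 : s' = l1 ++ b :: (l2 ++ n ++ l3))
      (e8 : r = l1 ++ m ++ (l2 ++ n ++ l3)),
    op_comp d e3 e4 ∘ (op_comp d e1 e2 ⊠ idm) =
    op_comp d e7 e8 ∘ (op_comp d e5 e6 ⊠ idm) ∘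
      swapr (op l d) (op m b) (op n c);
  op_comp_perm : forall l1 l1' l2 l2' m m' l l' s s' c d
      (p : reorder l l') (q : reorder m m') (r : reorder s s')
      (e1 : l = l1 ++ c :: l2) (e2 : s = l1 ++ m ++ l2)
      (e1' : l' = l1' ++ c :: l2') (e2' : s' = l1' ++ m' ++ l2'),
    block_reorder l1 l1' p q r ->
    op_perm d r ∘ op_comp d e1 e2 =
    op_comp d e1' e2' ∘ (op_perm d p ⊠ op_perm c q) }.

Section Tensors.
Variables (M : smcat) (C : Type).

Variable A : C -> M.

Fixpoint tens (l : seq C) : M := if l is c :: l' then A c ⊗ tens l' else munit.

Fixpoint tens_perm l l' (p : reorder l l') : mor (tens l) (tens l') :=
  match p with
  | reorder_id _ => idm
  | reorder_cons _ _ _ p => idm ⊠ tens_perm p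
  | reorder_swap x y l => swapl (A x) (A y) (tens l)
  | reorder_trans _ _ _ p q => tens_perm q ∘ tens_perm p
  end.

Fixpoint tens_cat l1 l2 : mor (tens (l1 ++ l2)) (tens l1 ⊗ tens l2) :=
  if l1 is c :: l1' then
    associ (A c) (tens l1') (tens l2) ∘ (idm ⊠ tens_cat l1' l2)
  else luniti (tens l2).

(* [f] applied in place of the block [m] of [l1 ++ m ++ l2] *)
Fixpoint tens_plug (x : M) m c (f : mor (x ⊗ tens m) (A c)) l1 l2 :
    mor (x ⊗ tens (l1 ++ m ++ l2)) (tens (l1 ++ c :: l2)) :=
  if l1 is b :: l1' then
    (idm ⊠ tens_plug f l1' l2) ∘ swapl x (A b) (tens (l1' ++ m ++ l2))
  else
    (f ⊠ idm) ∘ associ x (tens m) (tens l2) ∘ (idm ⊠ tens_cat m l2).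
End Tensors.

Record algebra (M : smcat) (C : Type) (P : operad M C) := Algebra {
  alg :> C -> M;
  act : forall l d, mor (op P l d ⊗ tens alg l) (alg d);
  act_unit : forall c,
    act [:: c] c ∘ (op_unit P c ⊠ runiti (alg c)) ∘ luniti (alg c) = idm;
  act_comp : forall l1 l2 m c d,
    act (l1 ++ m ++ l2) d ∘ (op_comp P d (erefl (l1 ++ c :: l2)) erefl ⊠ idm) =
    act (l1 ++ c :: l2) d ∘ (idm ⊠ tens_plug (act m c) l1 l2) ∘
      assoc (op P (l1 ++ c :: l2) d) (op P m c) (tens alg (l1 ++ m ++ l2));
  act_perm : forall l l' d (p : reorder l l'),
    act l' d ∘ (op_perm P d p ⊠ tens_perm alg p) = act l d }.

Lemma comp_tail (C : category) (x y z t : C) (g : mor y z) (f : mor x y)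
    (h : mor x z) (k : mor z t) :
  g ∘ f = h -> k ∘ g ∘ f = k ∘ h.
Proof. by move=> <-; rewrite compmA. Qed.

Lemma comp_tail3 (C : category) (x y z t u : C) (h : mor z t) (g : mor y z)
    (f : mor x y) (e : mor x t) (k : mor t u) :
  h ∘ g ∘ f = e -> k ∘ h ∘ g ∘ f = k ∘ e.
Proof. by move=> <-; rewrite !compmA. Qed.

Section MonoidalLemmas.
Variable M : smcat.

Lemma tensm_idD (x y z u : M) (g : mor y z) (f : mor x y) :
  (g ∘ f) ⊠ (@idm _ u) = (g ⊠ idm) ∘ (f ⊠ idm).
Proof. by rewrite -tensmD comp1m. Qed.

Lemma tensm_Did (x y z u : M) (g : mor y z) (f : mor x y) :
  (@idm _ u) ⊠ (g ∘ f) = (idm ⊠ g) ∘ (idm ⊠ f).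
Proof. by rewrite -tensmD comp1m. Qed.

Lemma associ_nat (x x' y y' z z' : M)
    (f : mor x x') (g : mor y y') (h : mor z z') :
  associ x' y' z' ∘ (f ⊠ (g ⊠ h)) = ((f ⊠ g) ⊠ h) ∘ associ x y z.
Proof.
rewrite -[LHS]compm1 -(associK x y z) -!compmA (compmA (_ ⊠ _)) -assoc_nat.
by rewrite -!compmA (compmA (associ _ _ _)) assocK comp1m.
Qed.

Lemma luniti_nat (x y : M) (f : mor x y) :
  luniti y ∘ f = (idm ⊠ f) ∘ luniti x.
Proof.
rewrite -[LHS]compm1 -(lunitiK x) -!compmA (compmA f) -lunit_nat.
by rewrite -!compmA (compmA (luniti _)) lunitK comp1m.
Qed.

Lemma runiti_nat (x y : M) (f : mor x y) :
  runiti y ∘ f = (f ⊠ idm) ∘ runiti x.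
Proof.
rewrite -[LHS]compm1 -(runitiK x) -!compmA (compmA f) -runit_nat.
by rewrite -!compmA (compmA (runiti _)) runitK comp1m.
Qed.

Lemma swapl_nat (x x' y y' z z' : M)
    (f : mor x x') (g : mor y y') (h : mor z z') :
  swapl x' y' z' ∘ (f ⊠ (g ⊠ h)) = (g ⊠ (f ⊠ h)) ∘ swapl x y z.
Proof.
rewrite /swapl -compmA associ_nat !compmA -assoc_nat; congr (_ ∘ _).
by rewrite -!compmA -!tensmD comp1m compm1 braid_nat.
Qed.
End MonoidalLemmas.

Section MonoidalFunctor.
Variables (M N : smcat) (F : smfunctor M N).

Lemma fmu_natl x x' y (f : mor x x') :
  fmu F x' y ∘ (fmap F f ⊠ idm) = fmap F (f ⊠ idm) ∘ fmu F x y.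
Proof. by rewrite -fmu_nat fmap1. Qed.

Lemma fmu_natr x y y' (f : mor y y') :
  fmu F x y' ∘ (idm ⊠ fmap F f) = fmap F (idm ⊠ f) ∘ fmu F x y.
Proof. by rewrite -fmu_nat fmap1. Qed.

Lemma fmu_associ x y z :
  fmap F (associ x y z) ∘ fmu F x (y ⊗ z) ∘ (idm ⊠ fmu F y z) =
  fmu F (x ⊗ y) z ∘ (fmu F x y ⊠ idm) ∘ associ (F x) (F y) (F z).
Proof.
have -> : fmu F (x ⊗ y) z ∘ (fmu F x y ⊠ idm) = fmap F (associ x y z) ∘
    (fmap F (assoc x y z) ∘ fmu F (x ⊗ y) z ∘ (fmu F x y ⊠ idm)).
  by rewrite !compmA -fmapD assocK fmap1 comp1m.
by rewrite fmu_assoc -!compmA associK compm1.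
Qed.

Lemma fmu_luniti x :
  fmu F munit x ∘ (feps F ⊠ idm) ∘ luniti (F x) = fmap F (luniti x).
Proof.
transitivity (fmap F (luniti x) ∘ (lunit (F x) ∘ luniti (F x))).
  rewrite -fmu_lunit !compmA -fmapD lunitK fmap1 comp1m //.
by rewrite lunitiK compm1.
Qed.

Lemma fmu_runiti x :
  fmu F x munit ∘ (idm ⊠ feps F) ∘ runiti (F x) = fmap F (runiti x).
Proof.
transitivity (fmap F (runiti x) ∘ (runit (F x) ∘ runiti (F x))).
  rewrite -fmu_runit !compmA -fmapD runitK fmap1 comp1m //.
by rewrite runitiK compm1.
Qed.

Lemma fmu_swapl x y z :
  fmap F (swapl x y z) ∘ fmu F x (y ⊗ z) ∘ (idm ⊠ fmu F y z) =
  fmu F y (x ⊗ z) ∘ (idm ⊠ fmu F x z) ∘ swapl (F x) (F y) (F z).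
Proof.
rewrite /swapl !fmapD !compmA -fmu_assoc.
rewrite -!compmA (compmA (fmap F (associ _ _ _))) fmu_associ !compmA.
rewrite (comp_tail _ (esym (fmu_natl _ (braid x y)))) !compmA.
by rewrite (comp_tail _ (esym (tensm_idD _ _ _))) fmu_braid tensm_idD !compmA.
Qed.

Lemma fmu_swapr x y z :
  fmap F (swapr x y z) ∘ fmu F (x ⊗ y) z ∘ (fmu F x y ⊠ idm) =
  fmu F (x ⊗ z) y ∘ (fmu F x z ⊠ idm) ∘ swapr (F x) (F y) (F z).
Proof.
rewrite /swapr !fmapD !compmA -fmu_associ.
rewrite -!compmA (compmA (fmap F (assoc _ _ _))) fmu_assoc !compmA.
rewrite (comp_tail _ (esym (fmu_natr _ (braid y z)))) !compmA.
by rewrite (comp_tail _ (esym (tensm_Did _ _ _))) fmu_braid tensm_Did !compmA.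
Qed.

Variable C : Type.

Section Operad.
Variable P : operad M C.

#[local] Obligation Tactic := cbv beta.
Program Definition operad_base : operad N C := @Operad N C
  (fun l d => F (op P l d))
  (fun l l' d p => fmap F (op_perm P d p))
  (fun c => fmap F (op_unit P c) ∘ feps F)
  (fun l1 l2 m l r c d e e' =>
     fmap F (op_comp P d e e') ∘ fmu F (op P l d) (op P m c))
  _ _ _ _ _ _ _ _.
Next Obligation. by move=> *; congr fmap; exact: op_perm_ext. Qed.
Next Obligation. by move=> *; rewrite op_perm1 fmap1. Qed.
Next Obligation. by move=> *; rewrite op_permD fmapD. Qed.
Next Obligation.
move=> l1 l2 l c d e e'; rewrite tensm_Did !compmA.
rewrite (comp_tail _ (fmu_natr _ (op_unit P c))) !compmA.
rewrite -!compmA (compmA (fmu F _ _)) fmu_runiti -!fmapD !compmA.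
by rewrite op_comp_unitr fmap1.
Qed.
Next Obligation.
move=> l d e e'; rewrite tensm_idD !compmA.
rewrite (comp_tail _ (fmu_natl _ (op_unit P d))) !compmA.
rewrite -!compmA (compmA (fmu F _ _)) fmu_luniti -!fmapD !compmA.
by rewrite op_comp_unitl fmap1.
Qed.
Next Obligation.
move=> l1 l2 m1 m2 n l m s u r b c d e1 e2 e3 e4 e5 e6 e7.
rewrite tensm_idD tensm_Did !compmA.
rewrite (comp_tail _ (fmu_natl _ _)) (comp_tail _ (fmu_natr _ _)) !compmA -!fmapD.
rewrite (op_comp_seq _ _ e1 e2 e3 e4 e5 e6 e7) fmapD.
by rewrite -!compmA; congr compm; rewrite !compmA fmu_assoc.
Qed.
Next Obligation.
move=> l1 l2 l3 m n l s s' r b c d e1 e2 e3 e4 e5 e6 e7 e8.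
have := op_comp_par P d e1 e2 e3 e4 e5 e6 e7 e8.
have := fmu_swapr (op P l d) (op P m b) (op P n c).
move: (swapr _ _ _) (swapr _ _ _) => k k' hk hc.
rewrite !tensm_idD !compmA !(comp_tail _ (fmu_natl _ _)) !compmA -!fmapD hc.
by rewrite fmapD -!compmA; congr compm; rewrite !compmA hk.
Qed.
Next Obligation.
move=> l1 l1' l2 l2' m m' l l' s s' c d p q r e1 e2 e1' e2' h.
rewrite (comp_tail _ (fmu_nat _ _ _)) !compmA -!fmapD.
by rewrite (op_comp_perm _ _ e1 e2 e1' e2' h).
Qed.
End Operad.

Fixpoint tens_base (A : C -> M) l : mor (tens (fun c => F (A c)) l) (F (tens A l)) :=
  if l is c :: l' then fmu F (A c) (tens A l') ∘ (idm ⊠ tens_base A l')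
  else feps F.

Section TensBase.
Variable A : C -> M.
Let FA := fun c => F (A c).

Lemma tens_base_perm l l' (p : reorder l l') :
  tens_base A l' ∘ tens_perm FA p = fmap F (tens_perm A p) ∘ tens_base A l.
Proof.
elim: p => {l l'} [l|x l l' p IH|x y l|l l' l'' p IHp q IHq] /=.
- by rewrite fmap1 comp1m compm1.
- rewrite -compmA -tensm_Did IH tensm_Did !compmA.
  by rewrite (fmu_natr _ _).
- have := fmu_swapl (A x) (A y) (tens A l).
  have := swapl_nat (@idm _ (FA x)) (@idm _ (FA y)) (tens_base A l).
  move: (swapl _ _ _) (swapl _ _ _) (swapl _ _ _) => k1 k2 k3 hn hk.
  by rewrite !tensm_Did !compmA hk -!compmA hn.
- by rewrite fmapD compmA IHq -!compmA IHp.
Qed.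

Lemma tens_base_cat l1 l2 :
  fmu F _ _ ∘ (tens_base A l1 ⊠ tens_base A l2) ∘ tens_cat FA l1 l2 =
  fmap F (tens_cat A l1 l2) ∘ tens_base A (l1 ++ l2).
Proof.
elim: l1 => [|c l1 IH] /=.
  rewrite -fmu_luniti -!compmA luniti_nat !compmA.
  by congr (_ ∘ _); rewrite -!compmA -!tensmD comp1m compm1.
rewrite fmapD -!compmA (compmA (fmap F (idm ⊠ _))) -fmu_natr.
rewrite -!compmA -tensm_Did -IH !tensm_Did !compmA fmu_associ.
rewrite -(compmA _ (associ _ _ _)) associ_nat !compmA.
congr (_ ∘ _ ∘ _); rewrite -!compmA -!tensmD; congr (_ ∘ _).
by rewrite comp1m.
Qed.

Lemma tens_base_plug x m c (f : mor (x ⊗ tens A m) (A c)) l1 l2 :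
  tens_base A (l1 ++ c :: l2) ∘
    tens_plug (A := FA) (fmap F f ∘ fmu F x (tens A m) ∘ (idm ⊠ tens_base A m))
      l1 l2 =
  fmap F (tens_plug f l1 l2) ∘ fmu F x _ ∘ (idm ⊠ tens_base A (l1 ++ m ++ l2)).
Proof.
elim: l1 => [|b l1 IH] /=.
  rewrite !fmapD -(compmA _ (fmap F (idm ⊠ _))) -fmu_natr -!compmA -tensm_Did.
  rewrite -tens_base_cat !tensm_Did !compmA.
  rewrite -(compmA _ (fmap F (associ _ _ _))) -(compmA _ (_ ∘ _)) fmu_associ.
  rewrite !compmA (comp_tail _ (associ_nat _ _ _)) !compmA.
  rewrite -fmu_natl; congr (_ ∘ _ ∘ _).
  by rewrite -!compmA -!tensmD !comp1m !compm1 compmA.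
have := fmu_swapl x (A b) (tens A (l1 ++ m ++ l2)).
have := swapl_nat (@idm _ (F x)) (@idm _ (FA b)) (tens_base A (l1 ++ m ++ l2)).
move: (swapl _ _ _) (swapl _ _ _) (swapl _ _ _) => k1 k2 k3 hn hk.
rewrite fmapD tensm_Did !compmA (comp_tail3 _ hk) !compmA (comp_tail _ hn) !compmA.
rewrite -fmu_natr.
congr (_ ∘ _); rewrite -!compmA; congr (_ ∘ _).
by rewrite -!tensm_Did !compmA IH.
Qed.
End TensBase.

Variables (P : operad M C) (A : algebra P).

Program Definition algebra_base : algebra (operad_base P) :=
  @Algebra N C (operad_base P) (fun c => F (A c))
  (fun l d => fmap F (act A l d) ∘ fmu F (op P l d) (tens A l) ∘
     (idm ⊠ tens_base A l))
  _ _ _.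
Next Obligation.
move=> c /=.
rewrite -(compmA _ (idm ⊠ _)) -tensmD comp1m fmu_runiti.
have -> : (fmap F (op_unit P c) ∘ feps F) ⊠ fmap F (runiti (A c)) =
    (fmap F (op_unit P c) ⊠ fmap F (runiti (A c))) ∘ (feps F ⊠ idm).
  by rewrite -tensmD compm1.
rewrite !compmA (comp_tail _ (fmu_nat _ _ _)) !compmA.
by rewrite (comp_tail3 _ (fmu_luniti _)) -!fmapD act_unit fmap1.
Qed.
Next Obligation.
move=> l1 l2 m c d /=.
rewrite -(compmA _ (idm ⊠ _) (_ ⊠ idm)) -tensmD comp1m compm1.
rewrite -(compmA _ (idm ⊠ _) (idm ⊠ _)) -tensm_Did tens_base_plug !tensm_Did.
rewrite !compmA -(compmA _ (idm ⊠ (idm ⊠ _))) -assoc_nat tensm1 !compmA.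
rewrite (comp_tail _ (fmu_natr _ _)) !compmA -fmapD.
rewrite (comp_tail3 _ (esym (fmu_assoc F _ _ _))) !compmA -fmapD -act_comp.
have -> x y z t u (g : mor y z) (f : mor x y) (h : mor t u) :
    (g ∘ f) ⊠ h = (g ⊠ idm) ∘ (f ⊠ idm) ∘ (idm ⊠ h) :> mor (tenso (s := N) x t) _.
  by rewrite -!tensmD !comp1m compm1.
by rewrite !compmA (comp_tail _ (fmu_natl _ _)) !compmA -fmapD.
Qed.
Next Obligation.
move=> l l' d p /=.
rewrite -(compmA _ (idm ⊠ _)) -tensmD comp1m tens_base_perm.
rewrite -[fmap F (op_perm _ _ _)]compm1 tensmD !compmA.
by rewrite (comp_tail _ (fmu_nat _ _ _)) !compmA -fmapD act_perm.
Qed.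
End MonoidalFunctor.

Section ColourPullback.
Variables (M : smcat) (D C : Type) (f : D -> C).

Fixpoint map_reorder l l' (p : reorder l l') : reorder (map f l) (map f l') :=
  match p with
  | reorder_id l => reorder_id (map f l)
  | reorder_cons x _ _ p => reorder_cons (f x) (map_reorder p)
  | reorder_swap x y l => reorder_swap (f x) (f y) (map f l)
  | reorder_trans _ _ _ p q => reorder_trans (map_reorder p) (map_reorder q)
  end.

Lemma reorder_pos_map l l' (p : reorder l l') : reorder_pos (map_reorder p) =1 reorder_pos p.
Proof.
elim: p => {l l'} [l|x l l' p IH|x y l|l l' l'' p IHp q IHq] i //=.
  by case: i => // i; rewrite IH.
by rewrite IHp IHq.
Qed.

Lemma map_cut l1 l2 l c : l = l1 ++ c :: l2 -> map f l = map f l1 ++ f c :: map f l2.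
Proof. by move=> ->; rewrite map_cat. Qed.

Lemma map_subst l1 m l2 r :
  r = l1 ++ m ++ l2 -> map f r = map f l1 ++ map f m ++ map f l2.
Proof. by move=> ->; rewrite !map_cat. Qed.

Lemma map_block l1 l1' m m' l l' s s'
    (p : reorder l l') (q : reorder m m') (r : reorder s s') :
  block_reorder l1 l1' p q r ->
  block_reorder (map f l1) (map f l1')
    (map_reorder p) (map_reorder q) (map_reorder r).
Proof.
case=> h1 h2 h3; split; rewrite ?size_map ?reorder_pos_map // => i hi.
  by rewrite !reorder_pos_map h2.
by move=> hn; rewrite !reorder_pos_map h3.
Qed.

Section Operad.
Variable P : operad M C.

#[local] Obligation Tactic := cbv beta.
Program Definition operad_pull : operad M D := @Operad M D
  (fun l d => op P (map f l) (f d))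
  (fun l l' d p => op_perm P (f d) (map_reorder p))
  (fun c => op_unit P (f c))
  (fun l1 l2 m l r c d e e' => op_comp P (f d) (map_cut e) (map_subst e'))
  _ _ _ _ _ _ _ _.
Next Obligation.
by move=> l l' d p q h; apply: op_perm_ext => i; rewrite !reorder_pos_map h.
Qed.
Next Obligation. by move=> l d; rewrite op_perm1. Qed.
Next Obligation. by move=> l l' l'' d p q; rewrite op_permD. Qed.
Next Obligation. by move=> *; exact: op_comp_unitr. Qed.
Next Obligation. by move=> *; exact: op_comp_unitl. Qed.
Next Obligation.
move=> l1 l2 m1 m2 n l m s u r b c d e1 e2 e3 e4 e5 e6 e7.
move: (map_cut e3) (map_subst e4); rewrite !map_cat => E3 E4.
exact: op_comp_seq.
Qed.
Next Obligation.
move=> l1 l2 l3 m n l s s' r b c d e1 e2 e3 e4 e5 e6 e7 e8.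
move: (map_cut e1) (map_subst e2) (map_cut e3) (map_subst e4).
move: (map_cut e5) (map_subst e6) (map_cut e7) (map_subst e8).
rewrite !map_cat /= => E5 E6 E7 E8 E1 E2 E3 E4.
exact: op_comp_par.
Qed.
Next Obligation.
by move=> *; apply: op_comp_perm; exact: map_block.
Qed.
End Operad.

Section TensPull.
Variable A : C -> M.
Let Af := fun d => A (f d).

Fixpoint tens_pull l : mor (tens Af l) (tens A (map f l)) :=
  if l is c :: l' then idm ⊠ tens_pull l' else idm.

Definition tens_cast l l' (e : l = l') : mor (tens A l) (tens A l') :=
  match e with erefl => idm end.

Lemma tens_pull_perm l l' (p : reorder l l') :
  tens_pull l' ∘ tens_perm Af p = tens_perm A (map_reorder p) ∘ tens_pull l.
Proof.
elim: p => {l l'} [l|x l l' p IH|x y l|l l' l'' p IHp q IHq] /=.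
- by rewrite comp1m compm1.
- by rewrite -!tensm_Did IH.
- by rewrite swapl_nat.
- by rewrite compmA IHq -!compmA IHp.
Qed.

Lemma tens_cast_cons c l l' (e : l = l') (e' : c :: l = c :: l') :
  tens_cast e' = idm ⊠ tens_cast e.
Proof. by case: l' / e e' => e'; rewrite (Prop_irrelevance e' erefl)/= tensm1. Qed.

Lemma tens_pull_cat l1 l2 (e : map f (l1 ++ l2) = map f l1 ++ map f l2) :
  (tens_pull l1 ⊠ tens_pull l2) ∘ tens_cat Af l1 l2 =
  tens_cat A (map f l1) (map f l2) ∘ tens_cast e ∘ tens_pull (l1 ++ l2).
Proof.
elim: l1 e => [|c l1 IH] /= e.
  by rewrite (Prop_irrelevance e erefl)/= compm1 luniti_nat.
have e' : map f (l1 ++ l2) = map f l1 ++ map f l2 by case: e.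
rewrite (tens_cast_cons e') !compmA -associ_nat -!compmA -!tensm_Did.
by rewrite IH !compmA.
Qed.

Lemma tens_pull_plug x m c (g : mor (x ⊗ tens A (map f m)) (A (f c))) l1 l2
    (e : map f (l1 ++ m ++ l2) = map f l1 ++ map f m ++ map f l2)
    (e' : map f l1 ++ f c :: map f l2 = map f (l1 ++ c :: l2)) :
  tens_pull (l1 ++ c :: l2) ∘
    tens_plug (A := Af) (g ∘ (idm ⊠ tens_pull m)) l1 l2 =
  tens_cast e' ∘ tens_plug g (map f l1) (map f l2) ∘
    (idm ⊠ (tens_cast e ∘ tens_pull (l1 ++ m ++ l2))).
Proof.
elim: l1 e e' => [|b l1 IH] /= e e'.
  rewrite (Prop_irrelevance e' erefl) /= comp1m.
  rewrite -!compmA -tensm_Did !compmA -tens_pull_cat tensm_Did !compmA.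
  rewrite (comp_tail _ (associ_nat _ _ _)) !compmA; congr (_ ∘ _ ∘ _).
  by rewrite -!tensmD !comp1m compm1.
have h : map f (l1 ++ m ++ l2) = map f l1 ++ map f m ++ map f l2 by case: e.
have h' : map f l1 ++ f c :: map f l2 = map f (l1 ++ c :: l2) by case: e'.
rewrite (tens_cast_cons h) (tens_cast_cons h') -tensm_Did.
have := swapl_nat (@idm _ x) (@idm _ (A (f b)))
  (tens_cast h ∘ tens_pull (l1 ++ m ++ l2)).
move: (swapl _ _ _) (swapl _ _ _) => k1 k2 hn.
rewrite !compmA (comp_tail _ hn) !compmA; congr (_ ∘ _).
by rewrite -!tensm_Did (IH h h').
Qed.
End TensPull.

Variables (P : operad M C) (A : algebra P).

#[local] Obligation Tactic := cbv beta.
Program Definition algebra_pull : algebra (operad_pull P) :=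
  @Algebra M D (operad_pull P) (fun d => A (f d))
  (fun l d => act A (map f l) (f d) ∘ (idm ⊠ tens_pull A l)) _ _ _.
Next Obligation.
move=> c /=; rewrite tensm1 tensm1 compm1; exact: act_unit.
Qed.
Next Obligation.
move=> l1 l2 m c d /=.
have act_compE L R (e1 : L = map f l1 ++ f c :: map f l2)
    (e2 : R = map f l1 ++ map f m ++ map f l2) :
  act A R (f d) ∘ (op_comp P (f d) e1 e2 ⊠ idm) =
  act A L (f d) ∘ (idm ⊠ (tens_cast A (esym e1) ∘
     tens_plug (act A (map f m) (f c)) (map f l1) (map f l2) ∘
     (idm ⊠ tens_cast A e2))) ∘ assoc _ _ _.
  subst L R; rewrite act_comp /= tensm1 comp1m compm1 //.
rewrite -(compmA _ (idm ⊠ _) (_ ⊠ idm)) -tensmD comp1m compm1.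
rewrite -(compmA _ (idm ⊠ _) (idm ⊠ _)) -tensm_Did.
rewrite (tens_pull_plug _ (map_subst erefl) (esym (map_cut erefl))).
rewrite -[op_comp _ _ _ _]compm1 -[tens_pull _ _]comp1m tensmD compmA act_compE.
rewrite -tensm1 -(compmA _ (assoc _ _ _)) assoc_nat !tensm_Did !compmA.
by rewrite !tensm1 compm1.
Qed.
Next Obligation.
move=> l l' d p /=.
rewrite -compmA -tensmD comp1m tens_pull_perm.
by rewrite -[op_perm _ _ _]compm1 tensmD compmA act_perm.
Qed.
End ColourPullback.

(* Modules over the enveloping category of [Q], whose objects are the lists of
   colours: contravariant (right) and covariant (left) ones. *)
Record right_module (M : smcat) (C : Type) (Q : operad M C) := RightModule {
  rmod :> seq C -> M;
  rmod_perm : forall l l', reorder l l' -> mor (rmod l) (rmod l');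
  rmod_act : forall l1 l2 m l r c, l = l1 ++ c :: l2 -> r = l1 ++ m ++ l2 ->
    mor (rmod l ⊗ op Q m c) (rmod r);
  rmod_perm_ext : forall l l' (p q : reorder l l'),
    reorder_pos p =1 reorder_pos q -> rmod_perm p = rmod_perm q;
  rmod_perm1 : forall l, rmod_perm (reorder_id l) = idm;
  rmod_permD : forall l l' l'' (p : reorder l l') (q : reorder l' l''),
    rmod_perm (reorder_trans p q) = rmod_perm q ∘ rmod_perm p;
  rmod_act_unit : forall l1 l2 l c
      (e : l = l1 ++ c :: l2) (e' : l = l1 ++ [:: c] ++ l2),
    rmod_act e e' ∘ (idm ⊠ op_unit Q c) ∘ runiti (rmod l) = idm;
  rmod_act_seq : forall l1 l2 m1 m2 n l m s u r b c
      (e1 : l = l1 ++ c :: l2) (e2 : s = l1 ++ m ++ l2)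
      (e3 : s = (l1 ++ m1) ++ b :: (m2 ++ l2))
      (e4 : r = (l1 ++ m1) ++ n ++ (m2 ++ l2))
      (e5 : m = m1 ++ b :: m2) (e6 : u = m1 ++ n ++ m2)
      (e7 : r = l1 ++ u ++ l2),
    rmod_act e3 e4 ∘ (rmod_act e1 e2 ⊠ idm) =
    rmod_act e1 e7 ∘ (idm ⊠ op_comp Q c e5 e6) ∘
      assoc (rmod l) (op Q m c) (op Q n b);
  rmod_act_par : forall l1 l2 l3 m n l s s' r b c
      (e1 : l = l1 ++ b :: (l2 ++ c :: l3))
      (e2 : s = l1 ++ m ++ (l2 ++ c :: l3))
      (e3 : s = (l1 ++ m ++ l2) ++ c :: l3)
      (e4 : r = (l1 ++ m ++ l2) ++ n ++ l3)
      (e5 : l = (l1 ++ b :: l2) ++ c :: l3)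
      (e6 : s' = (l1 ++ b :: l2) ++ n ++ l3)
      (e7 : s' = l1 ++ b :: (l2 ++ n ++ l3))
      (e8 : r = l1 ++ m ++ (l2 ++ n ++ l3)),
    rmod_act e3 e4 ∘ (rmod_act e1 e2 ⊠ idm) =
    rmod_act e7 e8 ∘ (rmod_act e5 e6 ⊠ idm) ∘
      swapr (rmod l) (op Q m b) (op Q n c);
  rmod_act_perm : forall l1 l1' l2 l2' m m' l l' s s' c
      (p : reorder l l') (q : reorder m m') (r : reorder s s')
      (e1 : l = l1 ++ c :: l2) (e2 : s = l1 ++ m ++ l2)
      (e1' : l' = l1' ++ c :: l2') (e2' : s' = l1' ++ m' ++ l2'),
    block_reorder l1 l1' p q r ->
    rmod_perm r ∘ rmod_act e1 e2 =
    rmod_act e1' e2' ∘ (rmod_perm p ⊠ op_perm Q c q) }.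

Record left_module (M : smcat) (C : Type) (Q : operad M C) := LeftModule {
  lmod :> seq C -> M;
  lmod_perm : forall l l', reorder l l' -> mor (lmod l) (lmod l');
  lmod_act : forall l1 l2 m l r c, l = l1 ++ c :: l2 -> r = l1 ++ m ++ l2 ->
    mor (op Q m c ⊗ lmod r) (lmod l);
  lmod_perm_ext : forall l l' (p q : reorder l l'),
    reorder_pos p =1 reorder_pos q -> lmod_perm p = lmod_perm q;
  lmod_perm1 : forall l, lmod_perm (reorder_id l) = idm;
  lmod_permD : forall l l' l'' (p : reorder l l') (q : reorder l' l''),
    lmod_perm (reorder_trans p q) = lmod_perm q ∘ lmod_perm p;
  lmod_act_unit : forall l1 l2 l c
      (e : l = l1 ++ c :: l2) (e' : l = l1 ++ [:: c] ++ l2),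
    lmod_act e e' ∘ (op_unit Q c ⊠ idm) ∘ luniti (lmod l) = idm;
  lmod_act_seq : forall l1 l2 m1 m2 n l m s u r b c
      (e1 : l = l1 ++ c :: l2) (e2 : s = l1 ++ m ++ l2)
      (e3 : s = (l1 ++ m1) ++ b :: (m2 ++ l2))
      (e4 : r = (l1 ++ m1) ++ n ++ (m2 ++ l2))
      (e5 : m = m1 ++ b :: m2) (e6 : u = m1 ++ n ++ m2)
      (e7 : r = l1 ++ u ++ l2),
    lmod_act e1 e2 ∘ (idm ⊠ lmod_act e3 e4) ∘
      assoc (op Q m c) (op Q n b) (lmod r) =
    lmod_act e1 e7 ∘ (op_comp Q c e5 e6 ⊠ idm);
  lmod_act_par : forall l1 l2 l3 m n l s s' r b c
      (e1 : l = l1 ++ b :: (l2 ++ c :: l3))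
      (e2 : s = l1 ++ m ++ (l2 ++ c :: l3))
      (e3 : s = (l1 ++ m ++ l2) ++ c :: l3)
      (e4 : r = (l1 ++ m ++ l2) ++ n ++ l3)
      (e5 : l = (l1 ++ b :: l2) ++ c :: l3)
      (e6 : s' = (l1 ++ b :: l2) ++ n ++ l3)
      (e7 : s' = l1 ++ b :: (l2 ++ n ++ l3))
      (e8 : r = l1 ++ m ++ (l2 ++ n ++ l3)),
    lmod_act e1 e2 ∘ (idm ⊠ lmod_act e3 e4) =
    lmod_act e5 e6 ∘ (idm ⊠ lmod_act e7 e8) ∘
      swapl (op Q m b) (op Q n c) (lmod r);
  lmod_act_perm : forall l1 l1' l2 l2' m m' l l' s s' c
      (p : reorder l l') (q : reorder m m') (r : reorder s s')
      (e1 : l = l1 ++ c :: l2) (e2 : s = l1 ++ m ++ l2)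
      (e1' : l' = l1' ++ c :: l2') (e2' : s' = l1' ++ m' ++ l2'),
    block_reorder l1 l1' p q r ->
    lmod_perm p ∘ lmod_act e1 e2 =
    lmod_act e1' e2' ∘ (op_perm Q c q ⊠ lmod_perm r) }.

(* Relative tensor product [X (x)_Q Z]: the colimit of the [X l ⊗ Z l]
   identifying the two actions of [Q] and of the permutations. *)
Section RelativeTensor.
Variables (M : cosmcat) (C : Type) (Q : operad M C).
Variables (X : right_module Q) (Z : left_module Q).

Inductive rt_vertex : Type :=
| rt_obj of seq C
| rt_act of seq C & seq C & seq C & C.

Inductive rt_edge : rt_vertex -> rt_vertex -> Type :=
| rt_left l1 l2 m c : rt_edge (rt_act l1 l2 m c) (rt_obj (l1 ++ m ++ l2))
| rt_right l1 l2 m c : rt_edge (rt_act l1 l2 m c) (rt_obj (l1 ++ c :: l2))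
| rt_perm l l' : reorder l l' -> rt_edge (rt_obj l) (rt_obj l').

Definition rt_dobj (v : rt_vertex) : M :=
  match v with
  | rt_obj l => X l ⊗ Z l
  | rt_act l1 l2 m c =>
      (X (l1 ++ c :: l2) ⊗ op Q m c) ⊗ Z (l1 ++ m ++ l2)
  end.

Definition rt_dmap u v (e : rt_edge u v) : mor (rt_dobj u) (rt_dobj v) :=
  match e with
  | rt_left l1 l2 m c =>
      rmod_act X (erefl (l1 ++ c :: l2)) (erefl (l1 ++ m ++ l2)) ⊠ idm
  | rt_right l1 l2 m c =>
      (idm ⊠ lmod_act Z (erefl (l1 ++ c :: l2)) (erefl (l1 ++ m ++ l2))) ∘
        assoc (X (l1 ++ c :: l2)) (op Q m c) (Z (l1 ++ m ++ l2))
  | rt_perm _ _ p => rmod_perm X p ⊠ lmod_perm Z p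
  end.

Definition rel_tensor : M :=
  apex (proj1_sig (colim (@Diagram (Graph rt_edge) M rt_dobj rt_dmap))).
End RelativeTensor.

Section Operations.
Variables (M : smcat) (C : Type) (P : operad M C).

(* Operations of [P] are the elements [munit -> P(l; d)] of its objects. *)
Record operation := Operation {
  inputs : seq C;
  output : C;
  element : mor munit (op P inputs output) }.

Inductive composite : operation -> operation -> operation -> Prop :=
| Composite l1 l2 m c d (x : mor munit (op P (l1 ++ c :: l2) d))
    (y : mor munit (op P m c)) :
    composite (Operation x) (Operation y)
      (Operation (op_comp P d (erefl (l1 ++ c :: l2)) (erefl (l1 ++ m ++ l2)) ∘
         (x ⊠ y) ∘ luniti munit)).

Definition coupling (A : algebra P) (I : operation) :
    mor (tens A (inputs I)) (A (output I)) :=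
  act A (inputs I) (output I) ∘ (element I ⊠ idm) ∘
    luniti (tens A (inputs I)).
End Operations.

Local Open Scope classical_set_scope.

Record stratification (C : Type) := Stratification {
  strata : set (set C);
  strata_countable : countable strata;
  strata_nonempty : forall S, strata S -> S !=set0;
  strata_cover : forall c, exists2 S, strata S & S c;
  strata_disjoint : trivIset strata id }.

Section Interfaces.
Variables (M : smcat) (C : Type) (P : operad M C) (Str : stratification C).

Definition supported (S : set C) (x : operation P) : Prop :=
  S (output x) /\ List.Forall S (inputs x).

Definition single_stratum (x : operation P) : Prop :=
  exists2 S, strata Str S & supported S x.

Definition mixed (x : operation P) : Prop := ~ single_stratum x.

Lemma supported_composite S x y z :
  supported S x -> supported S y -> composite x y z -> supported S z.
Proof.
move=> + + xyz; case: xyz => l1 l2 m c d x' y' [/= Sd Sx] [/= Sc Sy].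
split=> //=; move: Sx; rewrite !List.Forall_app => -[S1 S2]; split=> //.
by split=> //; exact: List.Forall_inv_tail S2.
Qed.

Lemma mixed_composite x y z : mixed x \/ mixed y -> composite x y z ->
  mixed z \/ single_stratum z.
Proof. by move=> _ _; exact/or_comm/EM. Qed.

Definition interface_closed (J : set (operation P)) : Prop :=
  mixed `<=` J /\
  forall x y z, (J x /\ J y) \/ (J x /\ single_stratum y) \/
      (single_stratum x /\ J y) ->
    composite x y z -> J z \/ single_stratum z.

Definition interfaces : set (operation P) :=
  \bigcap_(J in interface_closed) J.

Lemma interfaces_closed : interface_closed interfaces.
Proof.
split=> [x mx J [mJ _]|x y z _ _]; first exact: mJ.
by case: (EM (single_stratum z)) => [|nz]; [right|left=> J [mJ _]; exact: mJ].
Qed.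
End Interfaces.
Arguments interfaces {M C} P Str.

Definition restrict_operad (M : smcat) C (P : operad M C) (S : set C) :
    operad M S :=
  operad_pull (val : S -> C) P.

Definition restrict_algebra (M : smcat) C (P : operad M C) (S : set C)
    (A : algebra P) : algebra (restrict_operad P S) :=
  algebra_pull (val : S -> C) A.

Local Open Scope ring_scope.

HB.instance Definition _ (R : rcfType) :=
  NormedModule.copy R[i] ((R[i] : numClosedFieldType)^o).

Section Homology.
Variables (K : fieldType) (U V W : lmodType K).
Variables (d1 : {linear U -> V}) (d0 : {linear V -> W}).

Definition cycle_pred : {pred V} := fun v => d0 v == 0.

Lemma cycle_submod : GRing.submod_closed cycle_pred.
Proof.
split=> [|a u v]; first by apply/eqP; rewrite raddf0.
by move=> /eqP hu /eqP hv; apply/eqP; rewrite linearP hu hv scaler0 addr0.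
Qed.
HB.instance Definition _ :=
  GRing.isSubmodClosed.Build K V cycle_pred cycle_submod.

Record cycles := Cycles { cycle_val : V; _ : cycle_val \in cycle_pred }.
HB.instance Definition _ := [isSub for cycle_val].
HB.instance Definition _ := [Choice of cycles by <:].
HB.instance Definition _ := [SubChoice_isSubLmodule of cycles by <:].

Definition boundary_pred : {pred cycles} :=
  fun z => `[< exists u, d1 u = cycle_val z >].

Lemma boundary_submod : GRing.submod_closed boundary_pred.
Proof.
split=> [|a u v]; first by apply/asboolP; exists 0; rewrite raddf0.
move=> /asboolP[x hx] /asboolP[y hy]; apply/asboolP; exists (a *: x + y).
by rewrite linearP hx hy.
Qed.
HB.instance Definition _ :=
  GRing.isSubmodClosed.Build K cycles boundary_pred boundary_submod.

Definition homology : Type := Quotient.quot boundary_pred.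
HB.instance Definition _ := GRing.Zmodule.on homology.
HB.instance Definition _ := EqQuotient.on homology.

Local Open Scope quotient_scope.

Definition hscale (a : K) (x : homology) : homology :=
  \pi_homology (a *: repr x).

Lemma hscaleE a z : hscale a (\pi_homology z) = \pi_homology (a *: z).
Proof.
apply/eqP; rewrite -Quotient.idealrBE -scalerBr rpredZ //.
by rewrite Quotient.idealrBE reprK.
Qed.

Lemma hpiD x y : \pi_homology x + \pi_homology y = \pi_homology (x + y).
Proof. exact/esym/Quotient.pi_add. Qed.

Lemma hscaleA a b x : hscale a (hscale b x) = hscale (a * b) x.
Proof. by elim/quotW: x => x; rewrite (hscaleE b) !hscaleE scalerA. Qed.

Lemma hscale1 : left_id 1 hscale.
Proof. by elim/quotW=> x; rewrite hscaleE scale1r. Qed.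

Lemma hscaleDr : right_distributive hscale +%R.
Proof.
move=> a; elim/quotW=> x; elim/quotW=> y.
by rewrite hpiD !hscaleE scalerDr hpiD.
Qed.

Lemma hscaleDl x : {morph hscale^~ x : a b / a + b}.
Proof. by elim/quotW: x => x a b; rewrite !hscaleE scalerDl hpiD. Qed.

HB.instance Definition _ := GRing.Zmodule_isLmodule.Build K homology
  hscaleA hscale1 hscaleDr hscaleDl.
End Homology.

Section FreeLift.
Variables (K : fieldType) (S : choiceType) (V : lmodType K) (f : S -> V).

Lemma fgliftB : {morph (fglift f : {freeg S / K} -> V) : x y / x - y}.
Proof. exact: lift_is_additive. Qed.

Lemma fglift0 : fglift f (0 : {freeg S / K}) = 0.
Proof. by rewrite -(subrr 0) fgliftB subrr. Qed.

Lemma fgliftD : {morph (fglift f : {freeg S / K} -> V) : x y / x + y}.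
Proof.
move=> x y; rewrite -{1}[y]opprK fgliftB -[- y]add0r fgliftB fglift0.
by rewrite sub0r opprK.
Qed.

Lemma fglift_linear : linear (fglift f : {freeg S / K} -> V).
Proof.
have liftS : forall (I : Type) (r : seq I) (F : I -> {freeg S / K}),
    fglift f (\sum_(i <- r) F i) = \sum_(i <- r) fglift f (F i).
  move=> I r F; elim: r => [|i r IH]; last first.
    by rewrite !big_cons fgliftD IH.
  by rewrite !big_nil fglift0.
have liftZ : forall a x, fglift f (a *: x) = a *: fglift f x.
  move=> a x; rewrite {1}/GRing.scale/= /fgscale liftS.
  rewrite -[in RHS](freeg_sumE x) liftS scaler_sumr.
  by apply: eq_bigr => s _; rewrite !liftU scalerA.
by move=> a x y; rewrite fgliftD liftZ.
Qed.

HB.instance Definition _ :=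
  GRing.isLinear.Build K {freeg S / K} V *:%R (fglift f) fglift_linear.
End FreeLift.

Section SingularHomology.
Variable R : realType.

Definition std_simplex n : set 'rV[R]_n.+1 :=
  [set x | (forall i, 0 <= x ord0 i) /\ \sum_i x ord0 i = 1].
Arguments std_simplex : clear implicits.

Definition face_row n (i : 'I_n.+2) (x : 'rV[R]_n.+1) : 'rV[R]_n.+2 :=
  \row_j (if unlift i j is Some k then x ord0 k else 0).

Lemma face_rowP n (i : 'I_n.+2) (x : std_simplex n) :
  face_row i (val x) \in std_simplex n.+1.
Proof.
case: x => x /= /set_mem[x0 x1]; apply/mem_set; split=> [j|].
  by rewrite mxE; case: unliftP.
rewrite (bigD1_ord i) //= mxE unlift_none add0r -[RHS]x1.
by apply: eq_bigr => j _; rewrite mxE liftK.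
Qed.

Definition face n (i : 'I_n.+2) (x : std_simplex n) : std_simplex n.+1 :=
  exist _ (face_row i (val x)) (face_rowP i x).

Lemma face_continuous n (i : 'I_n.+2) : continuous (@face n i).
Proof.
have cr : continuous (@face_row n i).
  move=> x A [P Pn PA]; exists (fun _ k => P ord0 (fintype.lift i k)).
    by move=> r k; rewrite (ord1 r); move: (Pn ord0 (fintype.lift i k)); rewrite mxE liftK.
  move=> y Py; apply: PA => r j; rewrite (ord1 r) mxE.
  have := Pn ord0 j; rewrite mxE; case: unliftP => [k ->|->] Pj; first exact: Py.
  exact: nbhs_singleton Pj.
have cv : continuous (@face_row n i \o (set_val : std_simplex n -> _)).
  by move=> x; apply: continuous_comp; [exact: initial_continuous|exact: cr].
by apply: continuous_comp_initial => x; exact: cv.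
Qed.

Variable X : topologicalType.

Definition sing n := {s : std_simplex n -> X | `[< continuous s >]}.

Lemma sing_face_subproof n (i : 'I_n.+2) (s : sing n.+1) :
  `[< continuous (val s \o face i) >].
Proof.
apply/asboolP => x; apply: continuous_comp; first exact: face_continuous.
exact: (asboolW (valP s)).
Qed.

Definition sing_face n (i : 'I_n.+2) (s : sing n.+1) : sing n :=
  exist _ (val s \o face i) (sing_face_subproof i s).

Variable K : fieldType.

Definition chain n := {freeg (sing n) / K}.
HB.instance Definition _ n := GRing.Lmodule.on (chain n).

Definition chain_bd n : chain n.+1 -> chain n :=
  fglift (fun s => \sum_(i < n.+2) (-1) ^+ i *: << sing_face i s >> : chain n).
HB.instance Definition _ n := GRing.Linear.on (@chain_bd n).

Definition bd n : {linear chain n -> chain n.-1} :=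
  if n is m.+1 then @chain_bd m : {linear chain m.+1 -> chain m}
  else \0 : {linear chain 0 -> chain 0}.

Definition sing_homology n : lmodType K := homology (bd n.+1) (bd n).

Definition cochain n := sing n -> K^o.
HB.instance Definition _ n := GRing.Lmodule.on (cochain n).

Definition cochain_bd n (c : cochain n) : cochain n.+1 :=
  fun s => \sum_(i < n.+2) (-1) ^+ i * c (sing_face i s).

Lemma cochain_bd_linear n : linear (@cochain_bd n).
Proof.
move=> a c d; apply/funext => s.
transitivity (a * cochain_bd c s + cochain_bd d s); last by [].
rewrite /cochain_bd mulr_sumr -big_split; apply: eq_bigr => i _ /=.
rewrite mulrCA -mulrDr; congr (_ * _).
Qed.
HB.instance Definition _ n :=
  GRing.isLinear.Build K (cochain n) (cochain n.+1) *:%R (@cochain_bd n)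
    (@cochain_bd_linear n).

Definition cobd n : {linear cochain n.-1 -> cochain n} :=
  if n is m.+1 then @cochain_bd m : {linear cochain m -> cochain m.+1}
  else \0 : {linear cochain 0 -> cochain 0}.

Definition sing_cohomology n : lmodType K := homology (cobd n) (cobd n.+1).
End SingularHomology.


Section Basis.
Variables (K : fieldType) (V : lmodType K).

Definition is_basis (I : choiceType) (b : I -> V) : Prop :=
  bijective (fglift b : {freeg I / K} -> V).

(* The dimension as a cardinal: the class of the sets that index a basis. *)
Definition dimension : choiceType -> Prop :=
  fun I => exists b : I -> V, is_basis b.
End Basis.

Section Topology.
Variable R : realType.

Definition I01 : Type := `[0%R, 1%R]%classic : set R.
HB.instance Definition _ := Topological.on I01.

Definition homeomorphism (X Y : topologicalType) (f : X -> Y) (g : Y -> X) :=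
  [/\ continuous f, continuous g, cancel f g & cancel g f].

Definition homeomorphic (X Y : topologicalType) : Prop :=
  exists f g, @homeomorphism X Y f g.

Definition homotopic (X Y : topologicalType) (f g : X -> Y) : Prop :=
  exists H : X * I01 -> Y, [/\ continuous H,
    forall x (s : I01), val s = 0 -> H (x, s) = f x
  & forall x (s : I01), val s = 1 -> H (x, s) = g x].

Definition homotopy_equivalent (X Y : topologicalType) : Prop :=
  exists (f : X -> Y) (g : Y -> X), [/\ continuous f, continuous g,
    homotopic (g \o f) id & homotopic (f \o g) id].

Definition linear_iso (K : fieldType) (V W : lmodType K) : Prop :=
  exists f : {linear V -> W}, bijective f.

Section Families.
Variable E : I01 -> set R[i].

Definition total_space : set (I01 * R[i]) := [set p | E p.1 p.2].

Definition bundle_proj (p : total_space) : I01 := (val p).1.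

Definition locally_trivial : Prop := forall t0 : I01,
  exists U : set I01, [/\ open U, U t0 &
    exists (h : bundle_proj @^-1` U -> U * E t0)
           (h' : U * E t0 -> bundle_proj @^-1` U),
      homeomorphism h h' /\ forall p, val (h p).1 = bundle_proj (val p)].

Definition hausdorff_excess (A B : set R[i]) : \bar R :=
  ereal_sup [set ereal_inf [set (complex.Re `|z - w|)%:E | w in B] | z in A].

(* Extended-valued: it is [+oo] between the empty set and a nonempty one. *)
Definition hausdorff_dist (A B : set R[i]) : \bar R :=
  maxe 0%E (maxe (hausdorff_excess A B) (hausdorff_excess B A)).

Definition hausdorff_continuous : Prop :=
  (forall t, compact (E t)) /\
  forall t0, hausdorff_dist (E t) (E t0) @[t --> t0] --> 0%E.

Definition selection_tracked : Prop :=
  forall t0 z, E t0 z -> exists l : I01 -> R[i], l t0 = z /\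
    \forall t \near t0, {for t, continuous l} /\ E t (l t).
End Families.

Definition locally_separated (E E' : I01 -> set R[i]) : Prop :=
  forall t0 : I01, exists2 d : R, 0 < d & \forall t \near t0,
    forall z w, E t z -> E' t w -> d <= complex.Re `|z - w|.

Section RieszProjection.
Variable X : completeNormedModType R[i].

Definition is_resolvent (T : X -> X) (z : R[i]) (S : X -> X) : Prop :=
  [/\ continuous S, forall x, S (z *: x - T x) = x
    & forall x, z *: S x - T (S x) = x].

Definition spectrum (T : X -> X) : set R[i] :=
  [set z | ~ exists S, is_resolvent T z S].

Definition rectifiable_loop (g : R -> R[i]) : Prop :=
  [/\ {within `[0, 1], continuous g}, g 0 = g 1,
      bounded_variation 0 1 (fun s => complex.Re (g s))
    & bounded_variation 0 1 (fun s => complex.Im (g s))].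

(* The integral of [f] along the cycle [G], as a limit of Riemann-Stieltjes
   sums. *)
Definition is_contour_integral (Y : normedModType R[i]) (G : seq (R -> R[i]))
    (f : R[i] -> Y) (v : Y) : Prop :=
  (fun n => \sum_(g <- G) \sum_(k < n.+1)
     (g (k.+1%:R / n.+1%:R) - g (k%:R / n.+1%:R)) *: f (g (k%:R / n.+1%:R)))
    @ \oo --> v.

Definition two_pi_i : R[i] := Complex 0 (pi *+ 2).

(* [P] is (2 pi i)^-1 times the integral of (z - T)^-1 along a cycle in the
   resolvent set winding once around [E] and not around the rest of the
   spectrum. *)
Definition is_riesz_projection (T : X -> X) (E : set R[i]) (P : X -> X) : Prop :=
  exists (G : seq (R -> R[i])) (res : R[i] -> X -> X),
    [/\ E `<=` spectrum T,
        forall z, ~ spectrum T z -> is_resolvent T z (res z),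
        forall g, List.In g G -> rectifiable_loop g /\
          forall s, `[0, 1]%classic s -> ~ spectrum T (g s),
        forall w, spectrum T w ->
          is_contour_integral (Y := R[i]) G (fun z => (z - w)^-1)
            (if `[< E w >] then two_pi_i else 0)
      & forall x, is_contour_integral G (fun z => res z x) (two_pi_i *: P x)].

Definition norm_continuous (P : I01 -> X -> X) : Prop :=
  forall (t0 : I01) (e : R), 0 < e -> \forall t \near t0,
    forall x, `|P t x - P t0 x| <= Complex e 0 * `|x|.
End RieszProjection.

Definition riesz_tracked (G E : I01 -> set R[i]) : Prop :=
  exists (X : completeNormedModType R[i]) (T : I01 -> {linear X -> X})
         (P : I01 -> X -> X),
    [/\ forall t, continuous (T t), forall t, spectrum (T t) = G t,
        forall t, is_riesz_projection (T t) (E t) (P t)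
      & norm_continuous P].
End Topology.

(* The Hochschild-type objects, the residual spectral objects and the
   realization are data of the theory. *)
Record spectral_theory (R : realType) (N : cosmcat) := SpectralTheory {
  hochschild : forall (C : Type) (Q : operad N C), algebra Q -> right_module Q;
  residual : forall (C : Type) (Q : operad N C), left_module Q;
  realization : N -> set R[i] }.

Definition operadic_spectrum (R : realType) (N : cosmcat)
    (Sp : spectral_theory R N) (C : Type) (Q : operad N C) (B : algebra Q) : N :=
  rel_tensor (hochschild Sp B) (residual Sp Q).

Definition spectral_support (R : realType) (N : cosmcat) (Sp : spectral_theory R N)
    (C : Type) (Q : operad N C) (B : algebra Q) : set R[i] :=
  realization Sp (operadic_spectrum Sp B).

Section Supports.
Variables (R : realType) (M N : cosmcat) (F : smfunctor M N).
Variables (C : Type) (P : operad M C) (Str : stratification C).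
Variable Sp : spectral_theory R N.

Definition global_support (A : algebra P) : set R[i] :=
  spectral_support Sp (algebra_base F A).

Definition stratum_support (S : set C) (A : algebra P) : set R[i] :=
  spectral_support Sp (algebra_base F (restrict_algebra S A)).

Definition local_support (A : algebra P) : set R[i] :=
  \bigcup_(S in strata Str) stratum_support S A.

Definition residual_support (A : algebra P) : set R[i] :=
  global_support A `\` local_support A.

(* The assigned spectral supports of the morphisms induced by operations. *)
Variable Supp : operation P -> forall x y : M, mor x y -> set R[i].

Definition localized_support (I : operation P) (A : algebra P) : set R[i] :=
  residual_support A `&` Supp I (coupling A I).

Record admissible_deformation (A : I01 R -> algebra P) : Prop := Admissible {
  global_continuous : hausdorff_continuous (fun t => global_support (A t));
  local_continuous : hausdorff_continuous (fun t => local_support (A t));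
  local_sub_global : forall t S, strata Str S ->
    stratum_support S (A t) `<=` global_support (A t);
  residual_separated : locally_separated (fun t => residual_support (A t))
    (fun t => local_support (A t));
  residual_tracked : selection_tracked (fun t => residual_support (A t)) \/
    riesz_tracked (fun t => global_support (A t))
      (fun t => residual_support (A t));
  interface_localization : forall t, residual_support (A t) =
    \bigcup_(I in interfaces P Str) localized_support I (A t) }.
End Supports.

(* Main.v *)
From HB Require Import structures.
Require Import Defs.
From mathcomp Require Import all_boot all_order all_algebra.
From mathcomp Require Import all_classical all_reals all_analysis.
From mathcomp.multinomials Require Import freeg.
From mathcomp.real_closed Require Import complex.
Import GRing.Theory numFieldNormedType.Exports.
Local Open Scope classical_set_scope.
Local Open Scope ring_scope.
Local Open Scope quotient_scope.

(** The only geometric input is local triviality.  A local trivialization over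
[U] restricts, over each point [t] of [U], to a homeomorphism from the fiber over
[t] onto the model fiber ([locally_trivial_near]), so the homeomorphism type of
the fiber is a locally constant function on [[0, 1]].  The interval is connected,
hence this function is constant and any two fibers are homeomorphic
([locally_trivial_homeomorphic]).

The remaining conclusions are invariants of the homeomorphism type.  A continuous
map acts on singular simplices by composition, hence on chains and on cochains;
these actions commute with the (co)boundary and are functorial, so a pair of
inverse homeomorphisms gives inverse bijections that preserve cycles and
boundaries, and therefore isomorphisms of homology and cohomology
([homeomorphic_homology], [homeomorphic_cohomology]).  A linear isomorphism
carries bases to bases, which yields the equality of Betti numbers
([linear_iso_dimension]).  The same argument serves for the residual supports and
for each localized family, the latter being a bundle in its own right. *)

Set Implicit Arguments.
Unset Strict Implicit.
Unset Printing Implicit Defensive.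

(** * Maps induced on homology *)

Section InducedMap.
Variables (K : fieldType) (U V W U' V' W' : lmodType K).
Variables (d1 : {linear U -> V}) (d0 : {linear V -> W}).
Variables (d1' : {linear U' -> V'}) (d0' : {linear V' -> W'}).
Variable f : {linear V -> V'}.
Variable fZ : forall v, d0 v = 0 -> d0' (f v) = 0.
Variable fB : forall u, exists u', d1' u' = f (d1 u).

Lemma cycle_map_subproof (z : cycles d0) : f (val z) \in cycle_pred d0'.
Proof. by apply/eqP/fZ/eqP; exact: (valP z). Qed.

Definition cycle_map (z : cycles d0) : cycles d0' := Cycles (cycle_map_subproof z).

Lemma cycle_map_linear : linear cycle_map.
Proof. by move=> a x y; apply: val_inj; rewrite /= linearP. Qed.

Definition homology_map (x : homology d1 d0) : homology d1' d0' :=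
  \pi_(homology d1' d0') (cycle_map (repr x)).

(** The definition of [homology_map] picks a representative; two representatives
differ by a boundary, which [fB] sends to a boundary. *)
Lemma homology_mapE z :
  homology_map (\pi_(homology d1 d0) z) = \pi_(homology d1' d0') (cycle_map z).
Proof.
apply/eqP; rewrite -Quotient.idealrBE.
have : repr (\pi_(homology d1 d0) z) - z \in boundary_pred d1 (d0 := d0).
  by rewrite Quotient.idealrBE reprK.
move=> /asboolP[u du]; apply/asboolP; have [u' du'] := fB u.
by exists u'; rewrite du' du; apply/esym; rewrite /= linearB.
Qed.

Lemma homology_map_linear : linear homology_map.
Proof.
move=> a x y; elim/quotW: x => x; elim/quotW: y => y.
by rewrite !homology_mapE [a *: _]hscaleE hpiD homology_mapE cycle_map_linear
  -hpiD -hscaleE.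
Qed.
End InducedMap.

(** The conditions on [f] make it act on homology; those on its inverse [g] make
this action bijective, since a bijection of cycles that preserves boundaries may
still send a non-boundary to a boundary. *)
Lemma homology_iso (K : fieldType) (U V W U' V' W' : lmodType K)
    (d1 : {linear U -> V}) (d0 : {linear V -> W})
    (d1' : {linear U' -> V'}) (d0' : {linear V' -> W'})
    (f : {linear V -> V'}) (g : {linear V' -> V}) :
  cancel f g -> cancel g f ->
  (forall v, d0 v = 0 -> d0' (f v) = 0) ->
  (forall v, d0' v = 0 -> d0 (g v) = 0) ->
  (forall u, exists u', d1' u' = f (d1 u)) ->
  (forall u, exists u', d1 u' = g (d1' u)) ->
  linear_iso (homology d1 d0) (homology d1' d0').
Proof.
move=> fK gK fZ gZ fB gB.
pose lin := GRing.isLinear.Build _ _ _ _ _ (homology_map_linear fZ fB).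
pose fH : homology d1 d0 -> homology d1' d0' := homology_map d1' fZ.
pose lf : {linear homology d1 d0 -> homology d1' d0'} := HB.pack fH lin.
have lfE z : lf (\pi_(homology d1 d0) z) =
    \pi_(homology d1' d0') (cycle_map fZ z) by apply: homology_mapE.
exists lf, (homology_map d1 gZ) => x; elim/quotW: x => x.
  rewrite lfE homology_mapE //.
  by congr (\pi_(_) _); apply: val_inj; rewrite /= fK.
rewrite homology_mapE // lfE.
by congr (\pi_(_) _); apply: val_inj; rewrite /= gK.
Qed.

Lemma freeg_linear_ext (K : fieldType) (S : choiceType) (V : lmodType K)
    (f g : {linear {freeg S / K} -> V}) :
  (forall s, f << s >> = g << s >>) -> f =1 g.
Proof.
move=> fg x; rewrite -(freeg_sumE x) !linear_sum; apply: eq_bigr => s _.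
have -> : << coeff s x *g s >> = coeff s x *: << s >> :> {freeg S / K}.
  apply/eqP/freeg_eqP => y; rewrite [RHS]coeff_fgscale.
  by rewrite !coeffU mul1r.
by rewrite !linearZ /= fg.
Qed.

(** * Functoriality of singular homology and cohomology *)

Section SingularMaps.
Variables (R : realType) (K : fieldType).

Section InducedMaps.
Variables (X Y : topologicalType) (f : X -> Y) (fc : continuous f).

Lemma sing_map_subproof n (s : sing R X n) : `[< continuous (f \o val s) >].
Proof.
apply/asboolP => x; apply: continuous_comp; last exact: fc.
exact: (asboolW (valP s)).
Qed.

Definition sing_map n (s : sing R X n) : sing R Y n :=
  exist _ (f \o val s) (sing_map_subproof s).

Lemma sing_map_face n (i : 'I_n.+2) (s : sing R X n.+1) :
  sing_face i (sing_map s) = sing_map (sing_face i s).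
Proof. exact: val_inj. Qed.

Definition chain_map n : {linear chain R X K n -> chain R Y K n} :=
  fglift (fun s => << sing_map s >> : chain R Y K n).

Lemma chain_map_bd n (c : chain R X K n) :
  bd R Y K n (chain_map n c) = chain_map n.-1 (bd R X K n c).
Proof.
case: n c => [|n] c; first by rewrite linear0.
move: c; apply: (@freeg_linear_ext _ _ _ (bd R Y K n.+1 \o chain_map n.+1)
  (chain_map n \o bd R X K n.+1)) => s.
rewrite [LHS]/= [RHS]/=.
rewrite liftU scale1r /chain_bd !liftU !scale1r.
rewrite (linear_sum (chain_map n)).
apply: eq_bigr => i _; rewrite (linearZ_LR (chain_map n)) /=.
by rewrite liftU scale1r sing_map_face.
Qed.

Definition cochain_map n (c : cochain R Y K n) : cochain R X K n :=
  fun s => c (sing_map s).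

Lemma cochain_map_linear n : linear (@cochain_map n).
Proof. by []. Qed.

HB.instance Definition _ n := GRing.isLinear.Build K (cochain R Y K n)
  (cochain R X K n) *:%R (@cochain_map n) (@cochain_map_linear n).

Lemma cochain_map_bd n (c : cochain R Y K n.-1) :
  cobd R X K n (cochain_map c) = cochain_map (cobd R Y K n c).
Proof.
case: n c => [|n] c; first by [].
apply/funext => s; apply: eq_bigr => i _.
by rewrite /cochain_map sing_map_face.
Qed.
End InducedMaps.

Section Inverse.
Variables (X Y : topologicalType) (f : X -> Y) (g : Y -> X).
Variables (fc : continuous f) (gc : continuous g) (fK : cancel f g).

Lemma sing_mapK n (s : sing R X n) : sing_map gc (sing_map fc s) = s.
Proof. by apply: val_inj; apply/funext => x /=; rewrite fK. Qed.

Lemma chain_mapK n : cancel (chain_map fc n) (chain_map gc n).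
Proof.
apply: (@freeg_linear_ext _ _ _ (chain_map gc n \o chain_map fc n) idfun) => s.
by rewrite [LHS]/= !liftU scale1r liftU scale1r sing_mapK.
Qed.

Lemma cochain_mapK n :
  cancel (@cochain_map _ _ _ gc n) (@cochain_map _ _ _ fc n).
Proof. by move=> c; apply/funext => s; rewrite /cochain_map sing_mapK. Qed.
End Inverse.

Lemma homeomorphic_homology (X Y : topologicalType) k :
  homeomorphic X Y ->
  linear_iso (sing_homology R X K k) (sing_homology R Y K k).
Proof.
move=> [f [g [fc gc fK gK]]].
apply: (@homology_iso _ _ _ _ _ _ _ _ _ _ _ (chain_map fc k) (chain_map gc k)).
- exact: chain_mapK.
- exact: chain_mapK.
- by move=> c dc; rewrite chain_map_bd dc linear0.
- by move=> c dc; rewrite chain_map_bd dc linear0.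
- by move=> c; exists (chain_map fc k.+1 c); rewrite chain_map_bd.
- by move=> c; exists (chain_map gc k.+1 c); rewrite chain_map_bd.
Qed.

Lemma homeomorphic_cohomology (X Y : topologicalType) k :
  homeomorphic X Y ->
  linear_iso (sing_cohomology R X K k) (sing_cohomology R Y K k).
Proof.
move=> [f [g [fc gc fK gK]]].
apply: (@homology_iso _ _ _ _ _ _ _ _ _ _ _
  (@cochain_map _ _ _ gc k) (@cochain_map _ _ _ fc k)).
- exact: cochain_mapK.
- exact: cochain_mapK.
- by move=> c dc; rewrite (@cochain_map_bd _ _ _ gc k.+1) dc linear0.
- by move=> c dc; rewrite (@cochain_map_bd _ _ _ fc k.+1) dc linear0.
- by move=> c; exists (cochain_map gc c); rewrite cochain_map_bd.
- by move=> c; exists (cochain_map fc c); rewrite cochain_map_bd.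
Qed.
End SingularMaps.

(** [dimension V] is the class of the index sets of bases, so the equality is an
equality of classes: composing a basis with an isomorphism keeps its index set. *)
Lemma linear_iso_dimension (K : fieldType) (V W : lmodType K) :
  linear_iso V W -> dimension V = dimension W.
Proof.
suff transfer (V' W' : lmodType K) : linear_iso V' W' ->
    forall I, dimension V' I -> dimension W' I.
  move=> VW; apply/funext => I; apply/propext; split; apply: transfer => //.
  have [f [g fK gK]] := VW.
  pose lin := GRing.isLinear.Build _ _ _ _ g (can2_linear fK gK).
  by exists (HB.pack g lin : {linear _ -> _}), f.
move=> [f fbij] I [b bbij]; exists (f \o b).
rewrite /is_basis; suff -> : fglift (f \o b) = f \o fglift b by exact: bij_comp.
apply/funext; apply: (@freeg_linear_ext _ _ _ (fglift (f \o b)) (f \o fglift b)).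
by move=> s; rewrite /= !liftU !scale1r.
Qed.

(** * Homeomorphism types of topological spaces *)

Lemma homeomorphic_refl (X : topologicalType) : homeomorphic X X.
Proof. by exists id, id; split=> // x; apply: cvg_id. Qed.

Lemma homeomorphic_sym (X Y : topologicalType) :
  homeomorphic X Y -> homeomorphic Y X.
Proof. by move=> [f [g [? ? ? ?]]]; exists g, f. Qed.

Lemma homeomorphic_trans (Y X Z : topologicalType) :
  homeomorphic X Y -> homeomorphic Y Z -> homeomorphic X Z.
Proof.
move=> [f [g [fc gc fK gK]]] [f' [g' [fc' gc' fK' gK']]].
exists (f' \o f), (g \o g'); split; last 2 first.
- exact: can_comp.
- exact: can_comp.
- by move=> x; apply: continuous_comp; [exact: (fc x)|exact: (fc' (f x))].
- by move=> x; apply: continuous_comp; [exact: (gc' x)|exact: (gc (g' x))].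
Qed.

Lemma homeomorphic_homotopy_equivalent (R : realType) (X Y : topologicalType) :
  homeomorphic X Y -> homotopy_equivalent R X Y.
Proof.
have const (Z : topologicalType) (h : Z -> Z) : h =1 id -> homotopic R h id.
  move=> hE; exists fst; split=> // x; exact: cvg_fst.
move=> [f [g [fc gc fK gK]]]; exists f, g; split=> //; exact: const.
Qed.

(** * Fibers of locally trivial families *)

Lemma continuous_pair (X Y Z : topologicalType) (f : X -> Y) (g : X -> Z) :
  continuous f -> continuous g -> continuous (fun x => (f x, g x)).
Proof.
by move=> fc gc x; apply: (@cvg_pair _ _ _ _ (nbhs (f x)) (nbhs (g x)));
  [exact: fc|exact: gc].
Qed.

Lemma continuous_val (X : topologicalType) (A : set X) :
  continuous (val : A -> X).
Proof. exact: initial_continuous. Qed.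

Lemma continuous_set_type (X Y : topologicalType) (A : set Y) (f : X -> A) :
  continuous (fun x => val (f x)) -> continuous f.
Proof. by move=> fc; apply: continuous_comp_initial. Qed.

(** Openness of [B] and of its complement in the subtype gives open subsets of the
real line with these traces on the segment, so that the image of [B] in the line is
relatively clopen in the connected segment. *)
Lemma I01_connected (R : realType) (B : set (I01 R)) : open B -> open (~` B) ->
  forall s t, B s -> B t.
Proof.
move=> [C oC CB] [C' oC' CB'] s t Bs.
have valI (u : I01 R) : `[0%R, 1%R]%classic (val u) by exact: set_mem (valP u).
have BE x (u : I01 R) : val u = x -> B u <-> C x.
  by move=> <-; rewrite -CB.
have BE' x (u : I01 R) : val u = x -> ~ B u <-> C' x.
  by move=> <-; rewrite -[~ B u]/((~` B) u) -CB'.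
suff : [set val u | u in B] (val t) by move=> [u Bu] /val_inj <-.
suff -> : [set val u | u in B] = `[0%R, 1%R]%classic by exact: valI.
apply: segment_connected; first by exists (val s), s.
- exists C => //; apply/seteqP; split=> [_ [u Bu <-]|x [Ix Cx]].
    by split; [exact: valI|exact/BE].
  pose u : I01 R := exist _ x (mem_set Ix).
  by exists u => //; apply/(BE x u erefl).
- exists (~` C'); first exact: open_closedC.
  apply/seteqP; split=> [_ [u Bu <-]|x [Ix Cx]].
    by split; [exact: valI|move=> /(BE' _ u); exact].
  pose u : I01 R := exist _ x (mem_set Ix).
  by exists u => //; apply: contrapT => /(BE' x u erefl).
Qed.

(** The trivialization [h] commutes with the projections to the base, so its inverse
[h'] sends [{t} * E t0] into the fiber over [t]: the two restrict to inverse maps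
between [E t] and [E t0]. *)
Lemma locally_trivial_near (R : realType) (E : I01 R -> set R[i]) (t0 : I01 R) :
  locally_trivial E -> \forall t \near t0, homeomorphic (E t) (E t0).
Proof.
move=> triv; have [U [oU Ut0 [h [h' [[hc hc' hK hK'] hE]]]]] := triv t0.
apply: filterS (open_nbhs_nbhs (conj oU Ut0)) => t Ut.
pose u : U := exist _ t (mem_set Ut).
have inE (z : E t) : (t, val z) \in total_space E.
  exact/mem_set/(set_mem (valP z)).
pose in0 (z : E t) : total_space E := exist _ (t, val z) (inE z).
have inU (z : E t) : in0 z \in bundle_proj (E := E) @^-1` U.
  by apply: mem_set; exact: Ut.
pose inc (z : E t) : bundle_proj (E := E) @^-1` U := exist _ (in0 z) (inU z).
have base w : bundle_proj (val (h' (u, w))) = t by rewrite -hE hK'.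
have outE w : (val (val (h' (u, w)))).2 \in E t.
  rewrite -[t](base w); exact/mem_set/(set_mem (valP (val (h' (u, w))))).
pose out w : E t := exist (fun z => z \in E t) _ (outE w).
exists (fun z => (h (inc z)).2), out; split.
- have incc : continuous inc.
    do 2!apply: continuous_set_type.
    exact: (continuous_pair (fun=> cvg_cst _) (@continuous_val _ _)).
  move=> z; apply: (@continuous_comp _ _ _ (h \o inc) snd); last exact: cvg_snd.
  exact: continuous_comp (incc z) (hc (inc z)).
- apply: continuous_set_type => w.
  apply: (@continuous_comp _ _ _ (fun w => val (val (h' (u, w)))) snd);
    last exact: cvg_snd.
  apply: (@continuous_comp _ _ _ (fun w => val (h' (u, w))) val);
    last exact: continuous_val.
  apply: (@continuous_comp _ _ _ (fun w => h' (u, w)) val);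
    last exact: continuous_val.
  apply: (@continuous_comp _ _ _ (fun w => (u, w)) h'); last exact: hc'.
  exact: (continuous_pair (fun=> cvg_cst _) (fun=> cvg_id)).
- move=> z; apply: val_inj => /=.
  have hu : (h (inc z)).1 = u by apply: val_inj; rewrite hE.
  by rewrite -hu -surjective_pairing hK.
- move=> w; have -> : inc (out w) = h' (u, w); last by rewrite hK'.
  apply: val_inj; apply: val_inj => /=.
  by rewrite -[t in LHS](base w) [RHS]surjective_pairing.
Qed.

Lemma locally_trivial_homeomorphic (R : realType) (E : I01 R -> set R[i]) s t :
  locally_trivial E -> homeomorphic (E s) (E t).
Proof.
move=> triv.
(* The class of [s] is open, and so is its complement, a union of classes. *)
apply: (@I01_connected _ [set t | homeomorphic (E s) (E t)]) (homeomorphic_refl _).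
- rewrite openE => v sv; apply: filterS (locally_trivial_near v triv) => w wv.
  exact/(homeomorphic_trans sv)/homeomorphic_sym.
- rewrite openE => v sv; apply: filterS (locally_trivial_near v triv) => w wv sw.
  exact/sv/(homeomorphic_trans sw).
Qed.

Theorem theorem8 (R : realType) (M N : cosmcat) (F : smfunctor M N)
    (C : Type) (P : operad M C) (Str : stratification C)
    (Sp : spectral_theory R N)
    (Supp : operation P -> forall x y : M, mor x y -> set R[i])
    (A : I01 R -> algebra P) :
  let Rs := fun t => residual_support F Str Sp (A t) in
  let L := fun I t => localized_support F Str Sp Supp I (A t) in
  admissible_deformation F Str Sp Supp A ->
  locally_trivial Rs ->
  (forall s t, homeomorphic (Rs s) (Rs t) /\
    homotopy_equivalent R (Rs s) (Rs t) /\
    forall (K : fieldType) (k : nat),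
      linear_iso (sing_homology R (Rs s) K k) (sing_homology R (Rs t) K k) /\
      linear_iso (sing_cohomology R (Rs s) K k) (sing_cohomology R (Rs t) K k))
  /\
  ((forall t, trivIset (interfaces P Str) (fun I => L I t)) ->
   (forall I, interfaces P Str I -> locally_trivial (L I)) ->
   forall I, interfaces P Str I -> forall (K : fieldType) (k : nat),
     (forall t0 : I01 R, \forall t \near t0,
        linear_iso (sing_homology R (L I t) K k)
          (sing_homology R (L I t0) K k) /\
        linear_iso (sing_cohomology R (L I t) K k)
          (sing_cohomology R (L I t0) K k)) /\
     (forall s t, dimension (sing_homology R (L I s) K k) =
        dimension (sing_homology R (L I t) K k))).
Proof.
move=> Rs L _ Rtriv; split=> [s t|_ Ltriv I II K k].
  have st : homeomorphic (Rs s) (Rs t).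
    exact: locally_trivial_homeomorphic.
  split=> //; split; first exact: homeomorphic_homotopy_equivalent.
  by move=> K k; split;
    [exact: homeomorphic_homology|exact: homeomorphic_cohomology].
have st s t : homeomorphic (L I s) (L I t).
  exact/(locally_trivial_homeomorphic (E := L I))/Ltriv.
split=> [t0|s t]; last exact/linear_iso_dimension/homeomorphic_homology.
by near=> t; split; [exact: homeomorphic_homology|exact: homeomorphic_cohomology].
Unshelve. all: by end_near.
Qed.
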